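(* Let $L$ be a finite-dimensional monolithic strongly solvable Leibniz $A$-algebra over a field $F$. Then the maximal nilpotent subalgebras of $L$ are $L^2$ and the Cartan subalgebras of $L$ (that is, the subalgebras that are complementary to $L^2$).
   Context: A (right) Leibniz algebra over $F$ is a vector space with a bilinear product $[\,,]$ satisfying $[x,[y,z]]=[[x,y],z]-[[x,z],y]$ for all $x,y,z$. Ideals are two-sided. $L^1=L$, $L^{k+1}=[L^k,L]$, so $L^2=[L,L]$; $L$ is nilpotent if $L^k=0$ for some $k$. $L$ is abelian if $[x,y]=0$ for all $x,y$. $L$ is an $A$-algebra if every nilpotent subalgebra of $L$ is abelian. $L$ is strongly solvable (also called completely solvable) if $L^2$ is nilpotent. $L$ is monolithic if it has a unique minimal ideal. A maximal nilpotent subalgebra is a nilpotent subalgebra not properly contained in another nilpotent subalgebra. A Cartan subalgebra $C$ of $L$ is a nilpotent subalgebra that equals its normaliser $\{x\in L : [x,C]\subseteq C \text{ and } [C,x]\subseteq C\}$. A subalgebra $C$ is complementary to $L^2$ if $L$ is the vector space direct sum of $L^2$ and $C$.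
   Formalization: L^2 is claimed to be a maximal nilpotent subalgebra only when L^2 is nonzero; the claim fails for the one-dimensional abelian algebra, where L^2 = 0 and the only maximal nilpotent (and Cartan) subalgebra is L itself. *)

(* Defs.v *)
From HB Require Import structures.
From mathcomp Require Import all_boot all_order all_algebra.

Set Implicit Arguments.
Unset Strict Implicit.
Unset Printing Implicit Defensive.

Import GRing.Theory.
Local Open Scope ring_scope.

Section LeibnizAlgebras.

Variables (F : fieldType) (L : vectType F) (br : {bilinear L -> L -> L}).
Implicit Types (U V W I J C : {vspace L}) (x y z : L).

(* Right Leibniz identity: every right multiplication is a derivation. *)
Definition leibniz : Prop :=
  forall x y z, br x (br y z) = br (br x y) z - br (br x z) y.

(* [U, V], the span of all the products [u, v] (see brvP below). *)
Definition brv U V : {vspace L} :=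
  <<[seq br u v | u <- vbasis U, v <- vbasis V]>>%VS.

Lemma memv_brv U V x y : x \in U -> y \in V -> br x y \in brv U V.
Proof.
move=> Ux Vy; rewrite (coord_vbasis Ux) (coord_vbasis Vy).
rewrite linear_sumlz memv_suml // => i _; rewrite linear_sumr memv_suml // => j _.
rewrite linearZl_LR linearZr_LR !memvZ // memv_span //.
by apply/allpairsP; exists ((vbasis U)`_i, (vbasis V)`_j);
   rewrite !mem_nth ?size_tuple.
Qed.

Lemma brvP U V W :
  reflect (forall x y, x \in U -> y \in V -> br x y \in W) (brv U V <= W)%VS.
Proof.
apply: (iffP idP) => [sW x y Ux Vy | sW]; first exact: subvP sW _ (memv_brv _ _).
apply/span_subvP=> _ /allpairsP[[u v] /= [Uu Vv ->]].
by apply: sW; apply: vbasis_mem.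
Qed.

Definition subalgebra U : bool := (brv U U <= U)%VS.

Definition ideal I : bool := (brv I fullv <= I)%VS && (brv fullv I <= I)%VS.

Definition abelian U : Prop := {in U &, forall x y, br x y = 0}.

(* U^1 = U and U^(k+1) = [U^k, U]; the index 0 is junk, equal to index 1. *)
Definition lower_central U (k : nat) : {vspace L} :=
  iter k.-1 (fun V => brv V U) U.

Definition nilpotent U : Prop := exists k, lower_central U k = 0%VS.

Definition derived : {vspace L} := lower_central fullv 2.

Definition nilpotent_subalgebra U : Prop := subalgebra U /\ nilpotent U.

Definition A_algebra : Prop :=
  forall U, nilpotent_subalgebra U -> abelian U.

Definition strongly_solvable : Prop := nilpotent derived.

Definition minimal_ideal I : Prop :=
  [/\ ideal I, I != 0%VS
    & forall J, ideal J -> (J <= I)%VS -> J = 0%VS \/ J = I].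

Definition monolithic : Prop := exists! I, minimal_ideal I.

Definition maximal_nilpotent_subalgebra U : Prop :=
  nilpotent_subalgebra U /\
  forall V, nilpotent_subalgebra V -> (U <= V)%VS -> V = U.

Definition normalises x C : Prop :=
  forall c, c \in C -> br x c \in C /\ br c x \in C.

Definition cartan_subalgebra C : Prop :=
  nilpotent_subalgebra C /\ forall x, x \in C <-> normalises x C.

Definition complementary_subalgebra U C : Prop :=
  [/\ subalgebra C, (U + C = fullv)%VS & (U :&: C = 0)%VS].

End LeibnizAlgebras.

(* Main.v *)
Require Import Defs.
From mathcomp Require Import all_boot all_order all_algebra.

Set Implicit Arguments.
Unset Strict Implicit.
Unset Printing Implicit Defensive.

Import GRing.Theory.
Local Open Scope ring_scope.

(** Let V be an abelian ideal containing L^2.  Since [x, y] lies in L^2 and V is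
    abelian, each right multiplication R_y commutes on V with all left and right
    multiplications, so its kernel and the images R_y^n V are ideals.  All
    nonzero ideals contain the monolith, which forces R_y to be either injective
    or nilpotent on V; in the second case V + F y is nilpotent, hence abelian.
    As L is not nilpotent (when L^2 <> 0), some R_y is bijective on V, and
    V = [V, y] is contained in L^2.  So L^2 is maximal nilpotent, and R_u is
    bijective on L^2 for each u outside L^2.  If such a u lies in an abelian
    subalgebra U, then ker R_u is a complement of L^2 and centralises U. *)

(** * Right multiplications, ideals and the monolith *)

Section RightMultiplication.

Variables (F : fieldType) (L : vectType F) (br : {bilinear L -> L -> L}).
Implicit Types (U V W I J M C : {vspace L}) (x y z u v : L).

Definition rmul y : 'End(L) := linfun (applyr br y).

Lemma rmulE y x : rmul y x = br x y.
Proof. by rewrite lfunE. Qed.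

Lemma memv_lker_rmul y x : (x \in lker (rmul y)) = (br x y == 0).
Proof. by rewrite memv_ker rmulE. Qed.

Lemma idealP I :
  reflect (forall x y, x \in I -> br x y \in I /\ br y x \in I) (ideal br I).
Proof.
apply: (iffP andP) => [[/brvP rI /brvP lI] x y Ix | IP].
  by split; [apply: rI | apply: lI]; rewrite ?memvf.
by split; apply/brvP => x y ? ?; [case: (IP x y) | case: (IP y x)].
Qed.

Lemma mem_derived x y : br x y \in derived br.
Proof. exact: memv_brv (memvf x) (memvf y). Qed.

Lemma sub_derived_ideal V : (derived br <= V)%VS -> ideal br V.
Proof.
by move=> sV; apply/idealP => x y _; split; apply: subvP sV _ (mem_derived _ _).
Qed.

Lemma derived_eq0 : abelian br fullv <-> derived br = 0%VS.
Proof.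
split=> [abL | L2 x y _ _]; last by apply/eqP; rewrite -memv0 -L2 mem_derived.
apply/eqP; rewrite -subv0; apply/brvP => x y Lx Ly.
by rewrite (abL x y Lx Ly) mem0v.
Qed.

Lemma abelian_nilpotent U : abelian br U -> nilpotent_subalgebra br U.
Proof.
move=> abU; have UU0 : (brv br U U <= 0)%VS.
  by apply/brvP => x y Ux Uy; rewrite (abU x y Ux Uy) mem0v.
by split; [apply: subv_trans UU0 (sub0v _) | exists 2; apply/eqP; rewrite -subv0].
Qed.

Lemma abelian_add_line U y :
  abelian br U -> {in U, forall u, br u y = 0} ->
  {in U, forall u, br y u = 0} -> br y y = 0 -> abelian br (U + <[y]>).
Proof.
move=> abU Uy yU yy p q /memv_addP[u Uu [_ /vlineP[a ->] ->]].
move=> /memv_addP[v Uv [_ /vlineP[b ->] ->]].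
rewrite linearDl !linearDr /= !linearZl_LR !linearZr_LR /=.
by rewrite abU // Uy // yU // yy !scaler0 !addr0.
Qed.

(** Induction on the dimension of a nonzero ideal [I] not containing [W]: no ideal inside [I]
    contains [W] either, so the proper ones vanish, [I] is minimal, and uniqueness gives [I = W]. *)
Lemma monolithP :
  monolithic br ->
  exists2 W, W != 0%VS & forall I, ideal br I -> I != 0%VS -> (W <= I)%VS.
Proof.
case=> W [[_ W0 _] uniqW]; exists W => // I.
have [n] := ubnP (\dim I); elim: n I => // n IHn I leIn idI I0.
apply/negPn/negP => notWI.
suff minI : minimal_ideal br I by rewrite (uniqW _ minI) subvv in notWI.
split=> // J idJ sJI.
have [->|J0] := eqVneq J 0%VS; [by left | right; apply/eqP].
apply: contraNT notWI => neqJI; apply: subv_trans (sJI).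
apply: IHn => //; rewrite -ltnS; apply: leq_ltn_trans leIn.
rewrite ltn_neqAle dimvS // andbT.
by apply: contra neqJI => /eqP eqd; rewrite eqEdim sJI eqd leqnn.
Qed.

(** * Right multiplications on an abelian ideal above L^2 *)

Section AbelianIdeal.

Hypothesis leibniz_br : leibniz br.

Lemma rmul_derivation x y z : br (br x y) z = br (br x z) y + br x (br y z).
Proof. by rewrite leibniz_br addrC subrK. Qed.

Variables (V : {vspace L}) (abV : abelian br V) (sL2V : (derived br <= V)%VS).

Let derV x y : br x y \in V.
Proof. exact: subvP sL2V _ (mem_derived _ _). Qed.

(** The error term [v, [x, y]] is a product of two elements of the abelian [V]. *)
Lemma rmul_rmulC v x y : v \in V -> br (br v x) y = br (br v y) x.
Proof. by move=> Vv; rewrite rmul_derivation (abV Vv (derV x y)) addr0. Qed.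

Lemma rmul_lmulC v x y : v \in V -> br (br x v) y = br x (br v y).
Proof. by move=> Vv; rewrite rmul_derivation (abV (derV x y) Vv) add0r. Qed.

Lemma limg_rmul_ideal M y :
  (M <= V)%VS -> ideal br M -> ideal br (rmul y @: M)%VS.
Proof.
move=> /subvP sMV /idealP idM; apply/idealP => _ x /memv_imgP[m Mm ->].
have [Mmx Mxm] := idM m x Mm; rewrite rmulE; split.
  by rewrite rmul_rmulC ?sMV // -rmulE memv_img.
by rewrite -rmul_lmulC ?sMV // -rmulE memv_img.
Qed.

Lemma cap_lker_rmul_ideal y : ideal br (V :&: lker (rmul y))%VS.
Proof.
apply/idealP => v x; rewrite !memv_cap !memv_lker_rmul => /andP[Vv /eqP vy0].
by rewrite !derV (rmul_rmulC x y Vv) (rmul_lmulC x y Vv) vy0 linear0l linear0r eqxx.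
Qed.

Let image n y := iter n (lfun_img (rmul y)) V.

Lemma iter_limg_rmul_ideal n y : (image n y <= V)%VS && ideal br (image n y).
Proof.
elim: n => [|n /andP[sIV idI]]; first by rewrite subvv sub_derived_ideal.
rewrite /image iterS limg_rmul_ideal // andbT.
by apply/subvP => _ /memv_imgP[m _ ->]; rewrite rmulE.
Qed.

(** As long as R_y^n V is nonzero, it and the kernel of R_y on [V] both contain the monolith; so R_y
    kills something nonzero in R_y^n V, and the dimension drops. *)
Lemma iter_limg_rmul_eq0 y :
  monolithic br -> (V :&: lker (rmul y))%VS != 0%VS ->
  exists n, image n y = 0%VS.
Proof.
move=> /monolithP[W W0 sW] K0.
suff dimI n : image n y = 0%VS \/ (\dim (image n y) + n <= \dim V)%N.
  exists (\dim V).+1; case: (dimI (\dim V).+1) => //.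
  by rewrite addnS ltnNge leq_addl.
elim: n => [|n [I0|IHn]]; first by right; rewrite addn0.
  by left; rewrite /image iterS [iter _ _ _]I0 limg0.
have /andP[sIV idI] := iter_limg_rmul_ideal n y.
have [I0|I0] := eqVneq (image n y) 0%VS.
  by left; rewrite /image iterS [iter _ _ _]I0 limg0.
right; apply: leq_trans IHn; rewrite addnS -addSn leq_add2r /image iterS.
rewrite -[X in (_ < X)%N](limg_ker_dim (rmul y)) -[X in (X < _)%N]add0n ltn_add2r.
rewrite lt0n dimv_eq0; apply: contra W0; rewrite -!subv0; apply: subv_trans.
rewrite subv_cap sW //=; apply: subv_trans (capvSr V _).
by rewrite sW ?cap_lker_rmul_ideal.
Qed.

Lemma add_line_nilpotent n y :
  image n y = 0%VS -> nilpotent_subalgebra br (V + <[y]>).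
Proof.
move=> In0; split.
  by apply/brvP => u v _ _; apply: subvP (addvSl V _) _ (derV _ _).
(* The term of index n + 2 lies in R_y^n V: the first product falls into [V], and each later one
   advances by one image, since multiplying by [V] gives 0. *)
exists n.+2; apply/eqP; rewrite -subv0 -In0.
elim: n {In0} => [|n IHn]; first by apply/brvP => u v _ _.
apply/brvP => m _ /(subvP IHn) Im /memv_addP[v Vv [_ /vlineP[a ->] ->]].
have /andP[/subvP sIV _] := iter_limg_rmul_ideal n y.
by rewrite linearDr linearZr_LR (abV (sIV _ Im) Vv) add0r memvZ // -rmulE memv_img.
Qed.

Lemma rmul_injective_or_abelian y :
  monolithic br -> A_algebra br ->
  (V :&: lker (rmul y) = 0)%VS \/ abelian br (V + <[y]>).
Proof.
move=> monL AL; have [|K0] := eqVneq (V :&: lker (rmul y))%VS 0%VS; first by left.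
right; have [n In0] := iter_limg_rmul_eq0 monL K0.
exact: AL (add_line_nilpotent In0).
Qed.

Lemma limg_rmul_full y :
  (V :&: lker (rmul y) = 0)%VS -> (rmul y @: V)%VS = V.
Proof.
move=> K0; apply/eqP; rewrite eqEdim limg_dim_eq // leqnn andbT.
by apply/subvP => _ /memv_imgP[v _ ->]; rewrite rmulE.
Qed.

(** Otherwise every [V + <[y]>] is abelian, so [L^2, L] = 0; then L is nilpotent, hence abelian,
    against L^2 <> 0. *)
Lemma not_all_rmul_singular :
  monolithic br -> A_algebra br -> derived br <> 0%VS ->
  ~ forall y, (V :&: lker (rmul y))%VS <> 0%VS.
Proof.
move=> monL AL L2n0 sing; apply/L2n0/derived_eq0/AL; split; first exact: subvf.
exists 3; apply/eqP; rewrite -subv0; apply/brvP => v y L2v _.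
have [/sing // | abVy] := rmul_injective_or_abelian y monL AL.
rewrite abVy ?mem0v //; last by apply: subvP (addvSr _ _) _ (memv_line y).
exact: subvP (addvSl _ _) _ (subvP sL2V _ L2v).
Qed.

Lemma abelian_ideal_eq_derived :
  monolithic br -> A_algebra br -> derived br <> 0%VS -> V = derived br.
Proof.
move=> monL AL L2n0; apply/eqP; rewrite eqEsubv sL2V andbT.
apply/negPn/negP => notVL2; apply: (not_all_rmul_singular monL AL L2n0) => y.
move=> /limg_rmul_full imV; case/negP: notVL2; rewrite -imV.
by apply/subvP => _ /memv_imgP[v _ ->]; rewrite rmulE mem_derived.
Qed.

End AbelianIdeal.

End RightMultiplication.

(** * Maximal nilpotent, Cartan and complementary subalgebras *)

Section Monolithic.

Variables (F : fieldType) (L : vectType F) (br : {bilinear L -> L -> L}).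
Hypotheses (leibniz_br : leibniz br) (monL : monolithic br).
Hypotheses (solvL : strongly_solvable br) (AL : A_algebra br).
Implicit Types (U V C : {vspace L}) (x y z u v : L).

Local Notation L2 := (derived br).

Lemma abelian_derived : abelian br L2.
Proof. by apply: AL; split=> //; apply/brvP => x y _ _; apply: mem_derived. Qed.

Lemma derived_maximal_nilpotent :
  L2 <> 0%VS -> maximal_nilpotent_subalgebra br L2.
Proof.
move=> L2n0; split; first exact/abelian_nilpotent/abelian_derived.
by move=> V /AL abV sL2V; apply: abelian_ideal_eq_derived.
Qed.

(** If R_u is not injective on L^2, then L^2 + F u is again an abelian ideal above L^2, hence equal
    to L^2, although u lies outside. *)
Lemma rmul_injective_derived u :
  L2 <> 0%VS -> u \notin L2 -> (L2 :&: lker (rmul br u) = 0)%VS.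
Proof.
move=> L2n0 L2'u.
have [//|abu] :=
  rmul_injective_or_abelian leibniz_br abelian_derived (subvv _) u monL AL.
case/negP: L2'u.
rewrite -(abelian_ideal_eq_derived leibniz_br abu (addvSl _ _) monL AL L2n0).
exact: subvP (addvSr _ _) _ (memv_line u).
Qed.

Lemma rmul_derived_inj u a :
  L2 <> 0%VS -> u \notin L2 -> a \in L2 -> br a u = 0 -> a = 0.
Proof.
move=> L2n0 L2'u L2a au0; apply/eqP.
by rewrite -memv0 -(rmul_injective_derived L2n0 L2'u) memv_cap L2a
  memv_lker_rmul au0 eqxx.
Qed.

(** Both products lie in L^2, where R_u is injective, and the derivation R_u kills them because it
    kills x and c. *)
Lemma lker_rmul_centralises C u :
  L2 <> 0%VS -> abelian br C -> u \in C -> u \notin L2 ->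
  forall x c, br x u = 0 -> c \in C -> br x c = 0 /\ br c x = 0.
Proof.
move=> L2n0 abC Cu L2'u x c xu0 Cc.
split; apply: (rmul_derived_inj L2n0 L2'u); rewrite ?mem_derived //.
  by rewrite (rmul_derivation leibniz_br) xu0 linear0l add0r (abC c u) ?linear0r.
by rewrite (rmul_derivation leibniz_br) xu0 linear0r addr0 (abC c u) ?linear0l.
Qed.

Lemma abelian_sub_normalises C x : abelian br C -> x \in C -> normalises br x C.
Proof. by move=> abC Cx c Cc; rewrite !abC // mem0v. Qed.

Lemma cartan_maximal_nilpotent C :
  cartan_subalgebra br C -> maximal_nilpotent_subalgebra br C.
Proof.
case=> nilC normC; split=> // V /AL abV sCV; apply/eqP.
rewrite eqEsubv sCV andbT; apply/subvP => v Vv; apply/normC => c /(subvP sCV) Vc.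
by rewrite !abV // mem0v.
Qed.

(** By maximality such a [C] would be L^2, an ideal, whose normaliser is L; then L = L^2 would be
    abelian. *)
Lemma cartan_not_sub_derived C :
  L2 <> 0%VS -> cartan_subalgebra br C -> ~~ (C <= L2)%VS.
Proof.
move=> L2n0 cartC; apply/negP => sCL2.
have [nilL2 _] := derived_maximal_nilpotent L2n0.
have [_ maxC] := cartan_maximal_nilpotent cartC.
case: cartC => _; rewrite -(maxC _ nilL2 sCL2) => normL2.
apply: L2n0; apply/derived_eq0.
suff <- : L2 = fullv by apply: abelian_derived.
by apply/vspaceP => x; rewrite memvf; apply/normL2 => c _; rewrite !mem_derived.
Qed.

(** If x normalises [U], then [x, u] lies in the abelian [U], so R_u kills it and it is 0. Hence x
    centralises [U] and itself, and maximality absorbs it. *)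
Lemma maximal_nilpotent_cartan U :
  L2 <> 0%VS -> maximal_nilpotent_subalgebra br U -> ~~ (U <= L2)%VS ->
  cartan_subalgebra br U.
Proof.
move=> L2n0 [nilU maxU] /subvPn[u Uu L2'u]; have abU := AL nilU.
split=> // x; split; first exact: abelian_sub_normalises.
move=> normx; have inj := rmul_derived_inj L2n0 L2'u.
have xu0 : br x u = 0.
  by apply: inj; rewrite ?mem_derived // abU //; case: (normx u Uu).
have cent c : c \in U -> br x c = 0 /\ br c x = 0 by apply: lker_rmul_centralises xu0.
have xx0 : br x x = 0.
  apply: inj; rewrite ?mem_derived //.
  by rewrite (rmul_derivation leibniz_br) xu0 linear0l linear0r addr0.
have abUx : abelian br (U + <[x]>).
  by apply: abelian_add_line => // c /cent[].
rewrite -(maxU _ (abelian_nilpotent abUx) (addvSl _ _)).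
exact: subvP (addvSr _ _) _ (memv_line x).
Qed.

Lemma cartan_complementary C :
  L2 <> 0%VS -> cartan_subalgebra br C -> complementary_subalgebra br L2 C.
Proof.
move=> L2n0 cartC; have [[subC nilC] normC] := cartC.
have abC : abelian br C by apply: AL.
have /subvPn[u Cu L2'u] := cartan_not_sub_derived L2n0 cartC.
have K0 := rmul_injective_derived L2n0 L2'u.
split=> //.
  apply/vspaceP => x; rewrite memvf.
  (* Fitting-style splitting: some a in L^2 has [a, u] = [x, u], so x - a lies in the kernel of R_u,
     centralises [C], and hence belongs to it. *)
  have : br x u \in (rmul br u @: L2)%VS.
    by rewrite (limg_rmul_full (subvv _) K0) mem_derived.
  case/memv_imgP => a L2a; rewrite rmulE => xa.
  rewrite -(subrK a x) addrC memv_add //; apply/normC => c Cc.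
  have xau0 : br (x - a) u = 0 by rewrite linearBl xa subrr.
  by have [-> ->] := lker_rmul_centralises L2n0 abC Cu L2'u xau0 Cc; rewrite mem0v.
apply/eqP; rewrite -subv0 -K0 subv_cap capvSl.
apply/subvP => x; rewrite memv_cap memv_lker_rmul => /andP[_ Cx].
by rewrite abC.
Qed.

Lemma complementary_cartan C :
  L2 <> 0%VS -> complementary_subalgebra br L2 C -> cartan_subalgebra br C.
Proof.
move=> L2n0 [/brvP subC sumC capC].
have memC a : a \in L2 -> a \in C -> a = 0.
  by move=> L2a Ca; apply/eqP; rewrite -memv0 -capC memv_cap L2a.
have abC : abelian br C by move=> x y Cx Cy; apply: memC; rewrite ?mem_derived ?subC.
split=> [|x]; first exact: abelian_nilpotent.
split; first exact: abelian_sub_normalises.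
have: x \in (L2 + C)%VS by rewrite sumC memvf.
case/memv_addP => a L2a [c Cc ->] normx.
suff -> : a = 0 by rewrite add0r.
(* Here [a, L^2] = 0, and [a, C] lies in both [C] and L^2, so it vanishes too: a nonzero a would
   make every R_y singular on L^2. *)
apply/eqP/negPn/negP => a0.
apply: (not_all_rmul_singular leibniz_br abelian_derived (subvv _) monL AL L2n0).
move=> y /eqP; apply/negP; apply: contra a0 => /eqP K0.
rewrite -memv0 -K0 memv_cap L2a memv_lker_rmul.
have: y \in (L2 + C)%VS by rewrite sumC memvf.
case/memv_addP => b L2b [d Cd ->]; rewrite linearDr abelian_derived // add0r.
apply/eqP; apply: memC; first exact: mem_derived.
by case: (normx d Cd); rewrite linearDl (abC c d) // addr0.
Qed.

Lemma abelian_cartanE C :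
  abelian br fullv -> cartan_subalgebra br C <-> C = fullv.
Proof.
move=> abL; split=> [[_ normC] | ->].
  apply/vspaceP => x; rewrite memvf; apply/normC => c _.
  by rewrite !abL ?memvf // mem0v.
split=> [|x]; first exact: abelian_nilpotent.
by split=> [_ c _ | _]; rewrite ?memvf.
Qed.

Lemma abelian_maximal_nilpotentE U :
  abelian br fullv -> maximal_nilpotent_subalgebra br U <-> U = fullv.
Proof.
move=> abL; split=> [[_ maxU] | ->].
  by rewrite (maxU _ (abelian_nilpotent abL)) ?subvf.
split=> [|V _ sV]; first exact: abelian_nilpotent.
by apply/eqP; rewrite eqEsubv subvf.
Qed.

End Monolithic.

(* The side condition on L^2 only matters when L is abelian: then L is one
   dimensional, and L^2 = 0 is not a maximal nilpotent subalgebra. *)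
Theorem theorem5p2 (F : fieldType) (L : vectType F)
    (br : {bilinear L -> L -> L})
    (leibniz_br : leibniz br)
    (L_monolithic : monolithic br)
    (L_strongly_solvable : strongly_solvable br)
    (L_A_algebra : A_algebra br) :
  (forall U : {vspace L},
     maximal_nilpotent_subalgebra br U <->
     (U = derived br /\ derived br <> 0%VS) \/ cartan_subalgebra br U) /\
  (forall C : {vspace L},
     cartan_subalgebra br C <->
     complementary_subalgebra br (derived br) C).
Proof.
have [L20 | /eqP L2n0] := eqVneq (derived br) 0%VS.
  (* In the abelian case, being maximal nilpotent, Cartan or complementary to L^2 each means being
     all of L. *)
  have abL := (derived_eq0 br).2 L20.
  split=> [U | C].
    apply: (iff_trans (abelian_maximal_nilpotentE U abL)).
    split=> [/(abelian_cartanE U abL) | ]; first by right.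
    by case=> [[] // | /(abelian_cartanE U abL)].
  apply: (iff_trans (abelian_cartanE C abL)); rewrite L20.
  split=> [-> | [_ <- _]]; last by rewrite add0v.
  by split; rewrite ?add0v ?cap0v //; apply: subvf.
split=> [U | C]; last first.
  by split; [apply: cartan_complementary | apply: complementary_cartan].
split=> [maxU | [[-> _] | ]].
- have [sUL2 | notUL2] := boolP (U <= derived br)%VS.
    have [nilL2 _] :=
      derived_maximal_nilpotent leibniz_br L_monolithic L_strongly_solvable
        L_A_algebra L2n0.
    by left; case: maxU => _ /(_ _ nilL2 sUL2) <-.
  by right; apply: maximal_nilpotent_cartan.
- exact: derived_maximal_nilpotent.
- exact: cartan_maximal_nilpotent.
Qed.
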